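(* Let $(P,\cdot_P,\{-,-\}_P)$ be a coherent noncommutative Poisson algebra. Then $(P,\{-,-\}_P,[-,-]_P)$ is a compatible Lie algebra, where $[x,y]_P=x\cdot_Py-y\cdot_Px$ for all $x,y\in P$.
   Context: All vector spaces are finite dimensional over an algebraically closed field $\mathbb K$ of characteristic $0$. A noncommutative Poisson algebra $(P,\cdot_P,\{-,-\}_P)$ is a vector space with an associative (not necessarily commutative) product and a Lie bracket such that $\{x,y\cdot_Pz\}_P=\{x,y\}_P\cdot_Pz+y\cdot_P\{x,z\}_P$. It is coherent if $\{x,y\cdot_Pz\}_P+\{y,z\cdot_Px\}_P+\{z,x\cdot_Py\}_P=0$ for all $x,y,z\in P$. A compatible Lie algebra $(\mathfrak g,[-,-]_1,[-,-]_2)$ consists of two Lie algebras $(\mathfrak g,[-,-]_1)$ and $(\mathfrak g,[-,-]_2)$ on the same vector space such that for any $k_1,k_2\in\mathbb K$, $[x,y]=k_1[x,y]_1+k_2[x,y]_2$ defines a Lie algebra structure on $\mathfrak g$. *)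

(* Defs.v *)
From mathcomp Require Import all_boot all_order all_algebra.

Set Implicit Arguments.
Unset Strict Implicit.
Unset Printing Implicit Defensive.

Import GRing.Theory.
Local Open Scope ring_scope.

(* Products are bare operations on a vector space, since the associative
   algebras considered here need not have a unit. *)

Definition bilinear_op (K : fieldType) (V : vectType K) (m : V -> V -> V) :
    Prop :=
  bilinear_for *:%R *:%R m.

Record is_assoc_alg (K : fieldType) (A : vectType K) (mul : A -> A -> A) :
    Prop := IsAssocAlg {
  assoc_bilinear : bilinear_op mul;
  assoc_mulA : associative mul
}.

Record is_lie_alg (K : fieldType) (g : vectType K) (br : g -> g -> g) :
    Prop := IsLieAlg {
  lie_bilinear : bilinear_op br;
  lie_alternating : forall x, br x x = 0;
  lie_jacobi : forall x y z, br x (br y z) + br y (br z x) + br z (br x y) = 0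
}.

Record is_nc_poisson_alg (K : fieldType) (P : vectType K)
    (mul br : P -> P -> P) : Prop := IsNCPoissonAlg {
  poisson_assoc : is_assoc_alg mul;
  poisson_lie : is_lie_alg br;
  poisson_leibniz : forall x y z,
    br x (mul y z) = mul (br x y) z + mul y (br x z)
}.

Record is_coherent_nc_poisson_alg (K : fieldType) (P : vectType K)
    (mul br : P -> P -> P) : Prop := IsCoherentNCPoissonAlg {
  coherent_poisson : is_nc_poisson_alg mul br;
  poisson_coherence : forall x y z,
    br x (mul y z) + br y (mul z x) + br z (mul x y) = 0
}.

Record is_compatible_lie_alg (K : fieldType) (g : vectType K)
    (br1 br2 : g -> g -> g) : Prop := IsCompatibleLieAlg {
  compatible_lie1 : is_lie_alg br1;
  compatible_lie2 : is_lie_alg br2;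
  compatible_pencil : forall k1 k2 : K,
    is_lie_alg (fun x y => k1 *: br1 x y + k2 *: br2 x y)
}.

Definition commutator (K : fieldType) (A : vectType K) (mul : A -> A -> A)
    (x y : A) : A :=
  mul x y - mul y x.

(* Main.v *)
(* Only the mixed Jacobi identity of the pencil is not immediate. Coherence,
   applied to (x, y, z) and to (x, z, y), kills the cyclic sum of
   {x, [y, z]}. Since {x, -} is also a derivation of the commutator, that same
   cyclic sum equals -2 times the cyclic sum of [x, {y, z}], which therefore
   vanishes in characteristic 0. *)

Require Import Defs.
From mathcomp Require Import all_boot all_order all_algebra.

Set Implicit Arguments.
Unset Strict Implicit.
Unset Printing Implicit Defensive.

Import GRing.Theory.
Local Open Scope ring_scope.

Section BilinearOp.

Variables (K : fieldType) (V : vectType K).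
Implicit Types m : V -> V -> V.

Lemma bilinear_opPl m : bilinear_op m ->
  forall a x y z, m (a *: x + y) z = a *: m x z + m y z.
Proof. by move=> [ml _] a x y z; apply: ml. Qed.

Lemma bilinear_opPr m : bilinear_op m ->
  forall a x y z, m z (a *: x + y) = a *: m z x + m z y.
Proof. by move=> [_ mr] a x y z; apply: mr. Qed.

Lemma bilinear_opDl m : bilinear_op m ->
  forall x y z, m (x + y) z = m x z + m y z.
Proof.
by move=> bm x y z; rewrite -[x]scale1r (bilinear_opPl bm) !scale1r.
Qed.

Lemma bilinear_opDr m : bilinear_op m ->
  forall x y z, m z (x + y) = m z x + m z y.
Proof.
by move=> bm x y z; rewrite -[x]scale1r (bilinear_opPr bm) !scale1r.
Qed.

Lemma bilinear_op0r m : bilinear_op m -> forall z, m z 0 = 0.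
Proof.
by move=> bm z; apply: (@addrI _ (m z 0)); rewrite -(bilinear_opDr bm) !addr0.
Qed.

Lemma bilinear_opZr m : bilinear_op m ->
  forall a x z, m z (a *: x) = a *: m z x.
Proof.
move=> bm a x z.
by rewrite -[a *: x]addr0 (bilinear_opPr bm) (bilinear_op0r bm) addr0.
Qed.

Lemma bilinear_opBl m : bilinear_op m ->
  forall x y z, m (x - y) z = m x z - m y z.
Proof.
by move=> bm x y z; rewrite addrC -scaleN1r (bilinear_opPl bm) scaleN1r addrC.
Qed.

Lemma bilinear_opBr m : bilinear_op m ->
  forall x y z, m z (x - y) = m z x - m z y.
Proof.
by move=> bm x y z; rewrite addrC -scaleN1r (bilinear_opPr bm) scaleN1r addrC.
Qed.

Lemma bilinear_op_comb m1 m2 (k1 k2 : K) : bilinear_op m1 -> bilinear_op m2 ->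
  bilinear_op (fun x y => k1 *: m1 x y + k2 *: m2 x y).
Proof.
move=> b1 b2; split=> z a x y /=.
  rewrite (bilinear_opPl b1) (bilinear_opPl b2) !scalerDr !scalerA.
  by rewrite addrACA (mulrC a k1) (mulrC a k2).
rewrite (bilinear_opPr b1) (bilinear_opPr b2) !scalerDr !scalerA.
by rewrite addrACA (mulrC a k1) (mulrC a k2).
Qed.

Lemma commutator_bilinear m : bilinear_op m -> bilinear_op (commutator m).
Proof.
move=> bm; split=> z a x y; rewrite /commutator /=.
  by rewrite (bilinear_opPl bm) (bilinear_opPr bm) opprD scalerBr addrACA.
by rewrite (bilinear_opPl bm) (bilinear_opPr bm) opprD scalerBr addrACA.
Qed.

End BilinearOp.

Section Lie.

Variables (K : fieldType) (V : vectType K).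

(** Polarisation: expanding the vanishing bracket of [x + y] with itself leaves only the two cross
    terms. *)
Lemma lie_antisym (br : V -> V -> V) : is_lie_alg br ->
  forall x y, br x y = - br y x.
Proof.
move=> [bbr alt _] x y; apply/eqP; rewrite -addr_eq0.
move: (alt (x + y)); rewrite (bilinear_opDl bbr) !(bilinear_opDr bbr) !alt.
by rewrite add0r addr0 => ->.
Qed.

(* With T x y z = x (y z) + z (y x), associativity gives
   [x, [y, z]] = T x y z - T y z x, so the Jacobi sum telescopes. *)
Lemma commutator_lie (mul : V -> V -> V) : is_assoc_alg mul ->
  is_lie_alg (commutator mul).
Proof.
move=> [bm mA]; split; first exact: commutator_bilinear.
  by move=> x; apply: subrr.
pose T x y z := mul x (mul y z) + mul z (mul y x).
have commE x y z :
    commutator mul x (commutator mul y z) = T x y z - T y z x.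
  rewrite /commutator /T (bilinear_opBr bm) (bilinear_opBl bm) -!mA.
  by rewrite opprB addrACA opprD [- mul y _ + _]addrC.
by move=> x y z; rewrite !commE !subrKA subrr.
Qed.

(** The Jacobi sum of the pencil is a quadratic form in [k1] and [k2]. Its square coefficients are
    the Jacobi sums of [b1] and [b2], and its [k1 * k2] coefficient is the mixed sum, so the
    vanishing of the latter is exactly what has to be supplied. *)
Lemma lie_pencil (b1 b2 : V -> V -> V) : is_lie_alg b1 -> is_lie_alg b2 ->
  (forall x y z, (b1 x (b2 y z) + b2 x (b1 y z)) +
                 (b1 y (b2 z x) + b2 y (b1 z x)) +
                 (b1 z (b2 x y) + b2 z (b1 x y)) = 0) ->
  forall k1 k2 : K, is_lie_alg (fun x y => k1 *: b1 x y + k2 *: b2 x y).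
Proof.
move=> [bb1 alt1 jac1] [bb2 alt2 jac2] mixed k1 k2; split.
- exact: bilinear_op_comb.
- by move=> x; rewrite alt1 alt2 !scaler0 addr0.
have expand x y z :
    k1 *: b1 x (k1 *: b1 y z + k2 *: b2 y z) +
    k2 *: b2 x (k1 *: b1 y z + k2 *: b2 y z) =
    (k1 * k1) *: b1 x (b1 y z) + (k2 * k2) *: b2 x (b2 y z) +
    (k1 * k2) *: (b1 x (b2 y z) + b2 x (b1 y z)).
  rewrite (bilinear_opDr bb1) (bilinear_opDr bb2).
  rewrite !(bilinear_opZr bb1) !(bilinear_opZr bb2) !scalerDr !scalerA.
  by rewrite (mulrC k2 k1) [X in _ + X = _]addrC addrACA.
(* The interchanges collect the nine terms by coefficient: first the [k1 * k2] terms are split off,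
   then the two kinds of squares are separated. *)
move=> x y z; rewrite !expand [X in X + _ = _]addrACA [LHS]addrACA.
rewrite [X in X + _ + _ = _]addrACA [X in X + _ = _]addrACA -!scalerDr.
by rewrite jac1 jac2 mixed !scaler0 !addr0.
Qed.

End Lie.

Section Coherent.

Variables (K : fieldType) (P : vectType K) (mul br : P -> P -> P).
Hypothesis cohP : is_coherent_nc_poisson_alg mul br.

Lemma coherent_commutator x y z :
  br x (commutator mul y z) + br y (commutator mul z x) +
  br z (commutator mul x y) = 0.
Proof.
case: cohP => [[_ [bbr _ _] _] coh]; rewrite /commutator !(bilinear_opBr bbr).
rewrite [X in X + _ = _]addrACA [LHS]addrACA coh add0r -!opprD.
(* Swapping the last two summands turns the negated sum into coherence at [(x, z, y)]. *)
by rewrite [X in - X]addrAC coh oppr0.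
Qed.

(** A derivation of a product is a derivation of its commutator: subtract the Leibniz rules for
    [mul y z] and [mul z y]. *)
Lemma poisson_commutator x y z :
  br x (commutator mul y z) =
  commutator mul (br x y) z + commutator mul y (br x z).
Proof.
case: cohP => [[_ [bbr _ _] leib] _].
rewrite /commutator (bilinear_opBr bbr) !leib opprD.
by rewrite [- mul (br x z) y + _]addrC addrACA.
Qed.

Lemma commutator_coherent : 2%:R != 0 :> K -> forall x y z,
  commutator mul x (br y z) + commutator mul y (br z x) +
  commutator mul z (br x y) = 0.
Proof.
move=> two_neq0 x y z; set S := LHS.
have lieC : is_lie_alg (commutator mul).
  by apply: commutator_lie; case: cohP => [[]].
have lieB : is_lie_alg br by case: cohP => [[]].
(* Both antisymmetries put the derivation rule in the cyclic shape of [S]: when it is summed over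
   the rotations of [(x, y, z)], each term of [S] occurs exactly twice. *)
have derE u v w : br u (commutator mul v w) =
    - (commutator mul w (br u v) + commutator mul v (br w u)).
  rewrite poisson_commutator (lie_antisym lieC) (lie_antisym lieB u w)
    [RHS]opprD.
  (* Writing the opposite as [0 - br w u] lets the rule for differences carry the sign out of the
     commutator. *)
  congr (_ + _); rewrite -[- br w u]add0r.
  by rewrite (bilinear_opBr (lie_bilinear lieC)) (bilinear_op0r
    (lie_bilinear lieC)) add0r.
have := coherent_commutator x y z; rewrite !derE -!opprD => /eqP.
rewrite oppr_eq0.
have -> : commutator mul z (br x y) + commutator mul y (br z x) +
    (commutator mul x (br y z) + commutator mul z (br x y)) +
    (commutator mul y (br z x) + commutator mul x (br y z)) = 2%:R *: S.
  rewrite scaler_nat mulr2n {}/S.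
  move: (commutator mul x _) (commutator mul y _) (commutator mul z _).
  (* Positions 1 to 3 and 4 to 6 are the two copies of [a + b + c] in [S + S]; the pattern pairs
     them as [c + b], [a + c] and [b + a]. *)
  by move=> a b c; rewrite [RHS](AC (3*3) ((3*2)*(1*6)*(5*4))).
by rewrite scaler_eq0 (negPf two_neq0) => /eqP.
Qed.

End Coherent.

Theorem corollary2p12 (K : closedFieldType) (charK0 : [pchar K]%R =i pred0)
    (P : vectType K) (mul br : P -> P -> P) :
  is_coherent_nc_poisson_alg mul br ->
  is_compatible_lie_alg br (commutator mul).
Proof.
move=> cohP; have [[assocP lieP _] _] := cohP.
have lieC := commutator_lie assocP.
have two_neq0 : 2%:R != 0 :> K by rewrite (pcharf0P K).1.
split=> //; apply: lie_pencil => // x y z.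
(* The mixed sum splits into the cyclic sums of [br x (commutator mul y z)] and of
   [commutator mul x (br y z)], which vanish separately. *)
rewrite [X in X + _ = _]addrACA [LHS]addrACA (coherent_commutator cohP).
by rewrite (commutator_coherent cohP) ?addr0.
Qed.
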